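(* Let $(A,\cdot,[\cdot,\cdot,\cdot])$ be a coherence ternary $F$-manifold algebra and let $\mathcal B$ be a skew-symmetric bilinear form on $A$ satisfying, for all $x,y,z,u\in A$, $$\mathcal B(x\cdot y,z)+\mathcal B(y\cdot z,x)+\mathcal B(z\cdot x,y)=0,$$ $$\mathcal B([x,y,z],u)-\mathcal B([x,y,u],z)+\mathcal B([x,z,u],y)-\mathcal B([y,z,u],x)=0.$$ Then there is a compatible ternary pre-$F$-manifold algebra structure $(A,\diamond,\{\cdot,\cdot,\cdot\})$ on $A$ (i.e. one whose sub-adjacent ternary $F$-manifold algebra is $(A,\cdot,[\cdot,\cdot,\cdot])$) given by $$\mathcal B(x\diamond y,z)=\mathcal B(y,x\cdot z),\qquad \mathcal B(\{x,y,z\},u)=-\mathcal B(z,[x,y,u]).$$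
   Context: All vector spaces are over an algebraically closed field $\mathbb K$ of characteristic $0$. A 3-Lie algebra is a vector space $A$ with a skew-symmetric trilinear bracket satisfying $[x_1,x_2,[x_3,x_4,x_5]]=[[x_1,x_2,x_3],x_4,x_5]+[x_3,[x_1,x_2,x_4],x_5]+[x_3,x_4,[x_1,x_2,x_5]]$. A ternary $F$-manifold algebra is $(A,\cdot,[\cdot,\cdot,\cdot])$ with $(A,\cdot)$ commutative associative and $(A,[\cdot,\cdot,\cdot])$ a 3-Lie algebra such that, with $\mathcal L(x_1,x_2,x_3,x_4)=[x_1,x_2,x_3\cdot x_4]-x_3\cdot[x_1,x_2,x_4]-[x_1,x_2,x_3]\cdot x_4$, one has $\mathcal L(x_1\cdot x_2,x_3,x_4,x_5)=x_1\cdot\mathcal L(x_2,x_3,x_4,x_5)+x_2\cdot\mathcal L(x_1,x_3,x_4,x_5)$. A coherence ternary $F$-manifold algebra is a ternary $F$-manifold algebra such that, with $\mathcal K(x,y,z,u)=[x,y,z\cdot u]+[x,z,u\cdot y]+[x,u,y\cdot z]$, for all $x,y,z,t,u\in A$: $\mathcal L(x\cdot y,z,t,u)=\mathcal L(y,z,t,x\cdot u)+\mathcal L(x,z,t,y\cdot u)$; $\mathcal K(x\cdot y,z,t,u)=-\mathcal K(x,z,t,y\cdot u)-\mathcal K(y,z,t,x\cdot u)$; $\mathcal L(x,y,z,t)\cdot u=\mathcal K(y,z,t,x\cdot u)-x\cdot\mathcal K(y,z,t,u)$. A Zinbiel algebra is $(A,\diamond)$ with $\diamond$ bilinear and $x\diamond(y\diamond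 z)=(y\diamond x)\diamond z+(x\diamond y)\diamond z$. A 3-pre-Lie algebra is $(A,\{\cdot,\cdot,\cdot\})$ with a trilinear bracket satisfying, with $[x,y,z]=\{x,y,z\}+\{y,z,x\}+\{z,x,y\}$: $\{x,y,z\}=-\{y,x,z\}$; $\{x_1,x_2,\{x_3,x_4,x_5\}\}=\{[x_1,x_2,x_3],x_4,x_5\}+\{x_3,[x_1,x_2,x_4],x_5\}+\{x_3,x_4,\{x_1,x_2,x_5\}\}$; $\{[x_1,x_2,x_3],x_4,x_5\}=\{x_1,x_2,\{x_3,x_4,x_5\}\}+\{x_2,x_3,\{x_1,x_4,x_5\}\}+\{x_3,x_1,\{x_2,x_4,x_5\}\}$. A ternary pre-$F$-manifold algebra is $(A,\diamond,\{\cdot,\cdot,\cdot\})$ with $(A,\diamond)$ a Zinbiel algebra and $(A,\{\cdot,\cdot,\cdot\})$ a 3-pre-Lie algebra such that, with $x\cdot y=x\diamond y+y\diamond x$, $[x,y,z]=\{x,y,z\}+\{y,z,x\}+\{z,x,y\}$, $\mathcal L$ defined by the formula above from these operations, and $F_1(x_1,x_2,x_3,x_4)=\{x_1,x_2,x_3\diamond x_4\}-x_3\diamond\{x_1,x_2,x_4\}-[x_1,x_2,x_3]\diamond x_4$, $F_2(x_1,x_2,x_3,x_4)=x_3\diamond\{x_1,x_2,x_4\}+x_2\diamond\{x_1,x_3,x_4\}-\{x_1,x_2\cdot x_3,x_4\}$, one has for all $x_i\in A$: $F_1(x_1\cdot x_2,x_3,x_4,x_5)=x_1\diamond F_1(x_2,x_3,x_4,x_5)+x_2\diamond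 F_1(x_1,x_3,x_4,x_5)$; $F_2(x_1\cdot x_2,x_3,x_4,x_5)=x_1\diamond F_2(x_2,x_3,x_4,x_5)+x_2\diamond F_2(x_1,x_3,x_4,x_5)$; $\mathcal L(x_1,x_2,x_3,x_4)\diamond x_5=F_2(x_2,x_3,x_4,x_1\diamond x_5)-x_1\diamond F_2(x_2,x_3,x_4,x_5)$. Its sub-adjacent ternary $F$-manifold algebra is $(A,\cdot,[\cdot,\cdot,\cdot])$ with these operations $\cdot$ and $[\cdot,\cdot,\cdot]$.
   Formalization: The form is additionally assumed nondegenerate, in the sense that x ↦ B(x,·) is a bijection from A onto its dual (so A is finite-dimensional); without this the claim fails, e.g. for A = K with its field product, zero bracket and B = 0. *)

(* Defs.v *)
From mathcomp Require Import all_boot all_algebra.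

Set Implicit Arguments.
Unset Strict Implicit.
Unset Printing Implicit Defensive.

Import GRing.Theory.
Local Open Scope ring_scope.

Section TernaryAlgebras.

Variables (K : fieldType) (A : lmodType K).

Implicit Types (mul dia : A -> A -> A) (br tri : A -> A -> A -> A).

Definition bilinear_op mul : Prop :=
  (forall y, linear (fun x => mul x y)) /\ (forall x, linear (fun y => mul x y)).

Definition trilinear_op br : Prop :=
  [/\ forall y z, linear (fun x => br x y z),
      forall x z, linear (fun y => br x y z)
    & forall x y, linear (fun z => br x y z)].

Definition comm_assoc_algebra mul : Prop :=
  [/\ bilinear_op mul,
      forall x y, mul x y = mul y x
    & forall x y z, mul x (mul y z) = mul (mul x y) z].

(* The two transpositions generate the symmetric group on the arguments. *)
Definition skew_symmetric_op br : Prop :=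
  (forall x y z, br x y z = - br y x z) /\
  (forall x y z, br x y z = - br x z y).

Definition three_Lie_algebra br : Prop :=
  [/\ trilinear_op br,
      skew_symmetric_op br
    & forall x1 x2 x3 x4 x5,
        br x1 x2 (br x3 x4 x5) =
        br (br x1 x2 x3) x4 x5 + br x3 (br x1 x2 x4) x5
        + br x3 x4 (br x1 x2 x5)].

Definition opL mul br (x1 x2 x3 x4 : A) : A :=
  br x1 x2 (mul x3 x4) - mul x3 (br x1 x2 x4) - mul (br x1 x2 x3) x4.

Definition opK mul br (x y z u : A) : A :=
  br x y (mul z u) + br x z (mul u y) + br x u (mul y z).

Definition ternary_F_manifold_algebra mul br : Prop :=
  [/\ comm_assoc_algebra mul,
      three_Lie_algebra br
    & forall x1 x2 x3 x4 x5,
        opL mul br (mul x1 x2) x3 x4 x5 =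
        mul x1 (opL mul br x2 x3 x4 x5) + mul x2 (opL mul br x1 x3 x4 x5)].

Definition coherence_ternary_F_manifold_algebra mul br : Prop :=
  let L := opL mul br in
  let Kc := opK mul br in
  [/\ ternary_F_manifold_algebra mul br,
      forall x y z t u,
        L (mul x y) z t u = L y z t (mul x u) + L x z t (mul y u),
      forall x y z t u,
        Kc (mul x y) z t u = - Kc x z t (mul y u) - Kc y z t (mul x u)
    & forall x y z t u,
        mul (L x y z t) u = Kc y z t (mul x u) - mul x (Kc y z t u)].

Definition Zinbiel_algebra dia : Prop :=
  bilinear_op dia /\
  forall x y z, dia x (dia y z) = dia (dia y x) z + dia (dia x y) z.

Definition sub_mul dia (x y : A) : A := dia x y + dia y x.

Definition sub_br tri (x y z : A) : A := tri x y z + tri y z x + tri z x y.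

Definition three_pre_Lie_algebra tri : Prop :=
  let br := sub_br tri in
  [/\ trilinear_op tri,
      forall x y z, tri x y z = - tri y x z,
      forall x1 x2 x3 x4 x5,
        tri x1 x2 (tri x3 x4 x5) =
        tri (br x1 x2 x3) x4 x5 + tri x3 (br x1 x2 x4) x5
        + tri x3 x4 (tri x1 x2 x5)
    & forall x1 x2 x3 x4 x5,
        tri (br x1 x2 x3) x4 x5 =
        tri x1 x2 (tri x3 x4 x5) + tri x2 x3 (tri x1 x4 x5)
        + tri x3 x1 (tri x2 x4 x5)].

Definition opF1 dia tri (x1 x2 x3 x4 : A) : A :=
  tri x1 x2 (dia x3 x4) - dia x3 (tri x1 x2 x4) - dia (sub_br tri x1 x2 x3) x4.

Definition opF2 dia tri (x1 x2 x3 x4 : A) : A :=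
  dia x3 (tri x1 x2 x4) + dia x2 (tri x1 x3 x4) - tri x1 (sub_mul dia x2 x3) x4.

Definition ternary_pre_F_manifold_algebra dia tri : Prop :=
  let mul := sub_mul dia in
  let L := opL mul (sub_br tri) in
  let F1 := opF1 dia tri in
  let F2 := opF2 dia tri in
  [/\ Zinbiel_algebra dia,
      three_pre_Lie_algebra tri,
      forall x1 x2 x3 x4 x5,
        F1 (mul x1 x2) x3 x4 x5 =
        dia x1 (F1 x2 x3 x4 x5) + dia x2 (F1 x1 x3 x4 x5),
      forall x1 x2 x3 x4 x5,
        F2 (mul x1 x2) x3 x4 x5 =
        dia x1 (F2 x2 x3 x4 x5) + dia x2 (F2 x1 x3 x4 x5)
    & forall x1 x2 x3 x4 x5,
        dia (L x1 x2 x3 x4) x5 =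
        F2 x2 x3 x4 (dia x1 x5) - dia x1 (F2 x2 x3 x4 x5)].

(* (A, mul, br) is the sub-adjacent algebra of (A, dia, tri). *)
Definition compatible_with dia tri mul br : Prop :=
  (forall x y, mul x y = sub_mul dia x y) /\
  (forall x y z, br x y z = sub_br tri x y z).

(* The map x |-> B(x, -) from A to its dual space is bijective.  In finite     *)
(* dimension this is triviality of the radical; in infinite dimension a        *)
(* trivial radical does not make a prescription B(w, -) = f solvable in w.     *)
Definition nondegenerate_form (B : A -> A -> K) : Prop :=
  forall f : {scalar A}, exists! x : A, forall y : A, B x y = f y.

End TernaryAlgebras.

(* Main.v *)
(* Nondegeneracy provides adjoints with respect to B.  Putting dia x = (mul x)^*
   and tri x y = - (br x y)^*, the two invariance conditions on B say that
   (mul, br) is sub-adjacent to (dia, tri), and every axiom of a ternary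
   pre-F-manifold algebra is the adjoint of an identity of (mul, br).  Indeed
   F1(x, y, z, -) = L(x, y, z, -)^* and F2(x, y, z, -) = - K(x, y, z, -)^*.
   The F2-derivation axiom becomes
   K(xy, z, t, u) = K(x, z, t, yu) + K(y, z, t, xu), whose sign is opposite to
   that of the second coherence axiom; it holds because both sides vanish. *)
From HB Require Import structures.
Require Import Defs.
From mathcomp Require Import all_boot all_algebra.
From mathcomp Require Import ring.
From mathcomp Require boolp.
Import GRing.Theory.
Local Open Scope ring_scope.

Lemma bilinear_opP {K : fieldType} {A : lmodType K} {mul : A -> A -> A} :
  bilinear_op mul ->
  [/\ forall x y z, mul (x + y) z = mul x z + mul y z,
      forall x y z, mul x (y + z) = mul x y + mul x z,
      forall x y, mul (- x) y = - mul x y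
    & forall x y, mul x (- y) = - mul x y].
Proof.
move=> [mull mulr].
pose f y : {linear A -> A} :=
  HB.pack (mul^~ y) (GRing.isLinear.Build _ _ _ _ _ (mull y)).
pose g x : {linear A -> A} :=
  HB.pack (mul x) (GRing.isLinear.Build _ _ _ _ _ (mulr x)).
split=> [x y z|x y z|x y|x y].
- exact: (linearD (f z)).
- exact: (linearD (g x)).
- exact: (linearN (f y)).
- exact: (linearN (g x)).
Qed.

Section CoherenceIdentities.

Context {K : fieldType} {A : lmodType K}.
Context {mul : A -> A -> A} {br : A -> A -> A -> A}.

(* Substitute the fundamental identity for [x3, x5, [x1, x2, x4]] into the one
   for [x1, x2, [x3, x4, x5]]. *)
Lemma three_Lie_star (x1 x2 x3 x4 x5 : A) :
  three_Lie_algebra br ->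
  br (br x1 x2 x3) x4 x5 =
    - br x3 x4 (br x1 x2 x5) - br x1 x4 (br x2 x3 x5) - br x2 x4 (br x3 x1 x5).
Proof.
move=> [[_ lin2 lin3] [sk12 sk23] FI].
have brN x y z : br x y (- z) = - br x y z.
  by have [_ _ _ ->] := bilinear_opP (conj (lin2 x) (lin3 x)).
have := FI x1 x2 x3 x4 x5.
rewrite (sk23 x3 (br x1 x2 x4)) (FI x3 x5 x1 x2 x4).
rewrite (sk23 x3 x5 x4) brN (sk23 x1 (br x3 x5 x2)).
rewrite (sk12 (br x3 x5 x1) x2) (sk23 x2 (br x3 x5 x1)) opprK (sk23 x3 x5 x1) brN.
rewrite (sk23 x3 x5 x2) (sk12 x3 x2) opprK.
set a := br (br x1 x2 x3) x4 x5; set b := br x1 x2 _; set c := br x2 x4 _.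
set d := br x1 x4 _; set e := br x3 x4 _.
(* The substitution reproduces [b], i.e. [[x1, x2, [x3, x4, x5]]], on the right as well, so it
   cancels. *)
rewrite opprB addrCA -addrA -{1}[b]addr0 => /addrI /esym /eqP.
rewrite -addrA addr_eq0 => /eqP ->.
by rewrite opprD opprK addrC (addrC (- c)) addrA.
Qed.

Hypothesis coh : coherence_ternary_F_manifold_algebra mul br.

(** The products outside the bracket cancel in pairs, for instance [z[x,y,u]] against [[x,u,y]z], by
    skew-symmetry and commutativity. *)
Lemma opK_sum_opL x y z u :
  opK mul br x y z u =
    opL mul br x y z u + opL mul br x z u y + opL mul br x u y z.
Proof.
have [[[bil mulC _] [_ [_ sk23] _] _] _ _ _] := coh.
have [_ _ mulNl mulNr] := bilinear_opP bil.
rewrite /opK /opL (sk23 x z y) (sk23 x u y) (sk23 x u z) !mulNl !mulNr !opprK.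
rewrite (mulC (br x y z) u) (mulC (br x z u) y) (mulC (br x y u) z).
set a := br x y _; set b := br x z _; set c := br x u _.
set p := mul u _; set q := mul z _; set r := mul y _.
rewrite (addrAC b) [in RHS](addrACA (a - q)) addNr addr0 -(addrA c) (addrC r).
by rewrite (addrACA a) -opprD (addrC c) addrA subrK.
Qed.

(* Coherence 3 and the skew-symmetry of L in its first two arguments turn the
   right-hand side of coherence 2 into minus the derivation rule for K, which
   holds because K is a cyclic sum of L; hence 2 K(xy, z, t, u) = 0. *)
Lemma opK_mul_eq0 x y z t u : 2%:R != 0 :> K ->
  opK mul br (mul x y) z t u = 0.
Proof.
move=> two_neq0.
have [[[bil mulC _] [_ [sk12 _] _] Lder] _ coh2 coh3] := coh.
have [_ mulDr mulNl mulNr] := bilinear_opP bil.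
have Kder : opK mul br (mul x y) z t u =
    mul x (opK mul br y z t u) + mul y (opK mul br x z t u).
  rewrite !opK_sum_opL !Lder.
  move: (opL _ _ x z t u) (opL _ _ x t u z) (opL _ _ x u z t) => a b c.
  move: (opL _ _ y z t u) (opL _ _ y t u z) (opL _ _ y u z t) => a' b' c'.
  by rewrite !mulDr [RHS]addrACA; congr (_ + _); rewrite addrACA.
have Lskew a b c d : opL mul br a b c d = - opL mul br b a c d.
  by rewrite /opL !(sk12 a b) mulNl mulNr !opprD !opprK.
have: mul (opL mul br x y z t) u = - mul (opL mul br y x z t) u.
  by rewrite Lskew mulNl.
rewrite !coh3 opprB => /eqP; rewrite subr_eq addrAC eq_sym subr_eq.
rewrite (addrC (mul y _)) -Kder => /eqP Ksum.
have : 2%:R *: opK mul br (mul x y) z t u = 0.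
  rewrite scaler_nat mulr2n {1}Ksum coh2 -opprD.
  by rewrite (addrC (opK _ _ x _ _ _)) subrr.
by move/eqP; rewrite scaler_eq0 (negPf two_neq0) => /eqP.
Qed.
End CoherenceIdentities.

Section Adjoint.

Context {K : fieldType} {A : lmodType K} {B : {biscalar A}}.
Hypothesis B_nondeg : nondegenerate_form B.

(** Uniqueness half of nondegeneracy: identities in [A] may be tested by pairing with an arbitrary
    vector. *)
Lemma nondegenerate_inj (x y : A) : B x =1 B y -> x = y.
Proof.
move=> Bxy; have [w [_ wP]] := B_nondeg (B x).
by have <- := wP x (fun=> erefl _); apply: wP => z; apply/esym/Bxy.
Qed.

(** Existence half of nondegeneracy, applied to the functional [B y \o T]; [w] is the adjoint of [T]
    at [y]. *)
Lemma adjoint_exists {T : A -> A} (y : A) :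
  linear T -> exists w, forall z, B w z = B y (T z).
Proof.
move=> linT.
pose f : {linear A -> A} := HB.pack T (GRing.isLinear.Build _ _ _ _ _ linT).
have [w [wP _]] := B_nondeg (B y \o f : {scalar A}).
by exists w => z; rewrite wP.
Qed.

End Adjoint.

Theorem proposition5p13
  (K : closedFieldType) (charK0 : [pchar K] =i pred0) (A : lmodType K)
  (mul : A -> A -> A) (br : A -> A -> A -> A)
  (cohA : coherence_ternary_F_manifold_algebra mul br)
  (B : {biscalar A})
  (B_nondeg : nondegenerate_form B)
  (B_skew : forall x y : A, B x y = - B y x)
  (B_mul : forall x y z : A,
     B (mul x y) z + B (mul y z) x + B (mul z x) y = 0)
  (B_br : forall x y z u : A,
     B (br x y z) u - B (br x y u) z + B (br x z u) y - B (br y z u) x = 0) :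
  exists (dia : A -> A -> A) (tri : A -> A -> A -> A),
    [/\ forall x y z : A, B (dia x y) z = B y (mul x z),
        forall x y z u : A, B (tri x y z) u = - B z (br x y u),
        ternary_pre_F_manifold_algebra dia tri
      & compatible_with dia tri mul br].
Proof.
have two_neq0 : 2%:R != 0 :> K by rewrite ((pcharf0P K).1 charK0).
have [[[bil mulC mulA] [tril [sk12 sk23] FI] Lder] coh1 coh2 coh3] := cohA.
have [mulDl _ _ _] := bilinear_opP bil.
have [tl1 tl2 tl3] := tril.
(* Choice turns the pointwise adjoints into operations; their linearity is recovered later by
   pairing. *)
have [dia0 dia0P] := boolp.choice (fun p : A * A =>
  adjoint_exists B_nondeg p.2 (bil.2 p.1)).
have [tri0 tri0P] := boolp.choice (fun p : A * A * A =>
  adjoint_exists B_nondeg p.2 (tl3 p.1.1 p.1.2)).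
pose dia x y := dia0 (x, y); pose tri x y z := - tri0 (x, y, z).
have Bdia x y z : B (dia x y) z = B y (mul x z) by exact: (dia0P (x, y)).
have Btri x y z u : B (tri x y z) u = - B z (br x y u).
  by rewrite linearNl /= (tri0P (x, y, z)).
clearbody dia tri; clear dia0 dia0P tri0 tri0P.
have Binj := nondegenerate_inj B_nondeg.
have BDl x y z : B (x + y) z = B x z + B y z by exact: linearDl.
have BDr x y z : B x (y + z) = B x y + B x z by exact: linearDr.
have BNl x y : B (- x) y = - B x y by exact: linearNl.
have BNr x y : B x (- y) = - B x y by exact: linearNr.
have BPl a x y z : B (a *: x + y) z = a * B x z + B y z by exact: linearPl.
have BPr a x y z : B x (a *: y + z) = a * B x y + B x z by exact: linearPr.
have subM x y : sub_mul dia x y = mul x y.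
  apply: Binj => z; rewrite BDl !Bdia (B_skew y) (B_skew x) (mulC x z).
  by rewrite -[LHS]addr0 -(B_mul x y z); ring.
have subB x y z : sub_br tri x y z = br x y z.
  apply: Binj => u; rewrite !BDl !Btri (B_skew z) (B_skew x) (B_skew y).
  by rewrite (sk12 z x) BNl -[LHS]addr0 -(B_br x y z u); ring.
exists dia, tri; split=> //; last by split=> *; rewrite ?subM ?subB.
have F1adj x1 x2 x3 x4 w :
    B (opF1 dia tri x1 x2 x3 x4) w = B x4 (opL mul br x1 x2 x3 w).
  rewrite /opF1 subB !(BDl, BNl, Bdia, Btri) /opL !(BDr, BNr).
  by ring.
have F2adj x1 x2 x3 x4 w :
    B (opF2 dia tri x1 x2 x3 x4) w = - B x4 (opK mul br x1 x2 x3 w).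
  rewrite /opF2 subM !(BDl, BNl, Bdia, Btri) /opK (sk23 x1 w) !(BDr, BNr).
  by rewrite (mulC w x2); ring.
have Lsub x1 x2 x3 x4 :
    opL (sub_mul dia) (sub_br tri) x1 x2 x3 x4 = opL mul br x1 x2 x3 x4.
  by rewrite /opL !subM !subB.
split.
- split=> [|x y z].
    split=> [y a x x'|x a y y']; apply: Binj => z; rewrite BPl !Bdia.
      by rewrite (bil.1 z) BPr.
    by rewrite BPl.
  (* The Zinbiel identity is adjoint to [y(xw) = (yx)w]. *)
  apply: Binj => w; rewrite BDl !Bdia -BDr -mulDl.
  by rewrite -[dia y x + _]/(sub_mul dia y x) subM mulA.
- split=> [|x y z|x1 x2 x3 x4 x5|x1 x2 x3 x4 x5].
  + split=> [y z a x x'|x z a y y'|x y a z z']; apply: Binj => u;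
      rewrite BPl !Btri.
    * by rewrite tl1 BPr; ring.
    * by rewrite tl2 BPr; ring.
    * by rewrite BPl; ring.
  + by apply: Binj => u; rewrite BNl !Btri (sk12 x y) BNr.
  (* Adjoints reverse composition, so the fundamental identity expands the last term of the
     right-hand side. *)
  + apply: Binj => w; rewrite !subB !BDl !Btri (FI x1 x2 x3 x4 w) !BDr.
    by ring.
  + apply: Binj => w; rewrite subB !BDl !Btri.
    by rewrite (three_Lie_star x1 x2 x3 x4 w) // !(BDr, BNr); ring.
(* The F1 axiom is adjoint to the first coherence identity. *)
- move=> x1 x2 x3 x4 x5; apply: Binj => w.
  by rewrite subM F1adj BDl !Bdia !F1adj coh1 BDr.
- move=> x1 x2 x3 x4 x5; apply: Binj => w.
  rewrite subM F2adj BDl !Bdia !F2adj.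
  (* The second coherence identity leaves [K(x1 x2, x3, x4, w)] with opposite signs on the two
     sides, hence the need for its vanishing. *)
  by rewrite -!BNr -BDr addrC -coh2 !(opK_mul_eq0 cohA) // oppr0.
- move=> x1 x2 x3 x4 x5; apply: Binj => w.
  (* The last axiom is adjoint to the third coherence identity. *)
  rewrite Lsub Bdia BDl BNl Bdia !F2adj Bdia coh3 !(BDr, BNr).
  by ring.
Qed.
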